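(* Let $N\ge0$. For parameters (indeterminates) $t,s,r$, $$C_N(t,r)=C_N(t,s)\,C_N(s,r).$$ In particular, $$C_N(t,t)=I,\qquad C_N(t,s)^{-1}=C_N(s,t).$$
   Context: A strict partition is a finite sequence $\lambda=(\lambda_1>\cdots>\lambda_\ell>0)$ of integers, with $|\lambda|=\sum\lambda_i$, $\ell(\lambda)=\ell$; $\mathrm{SP}(N)$ is the set of strict partitions of $N$. Let $\Gamma=\mathbb{Q}[p_1,p_3,p_5,\ldots]$ be the ring of odd power sums, graded by $\deg p_n=n$, with degree-$N$ component $\Gamma_N$. The Schur $Q$-functions $Q_\lambda\in\Gamma$ are defined as follows: $q_r$ is given by $\sum_{r\ge0}q_rz^r=\exp\bigl(2\sum_{n\ge1,\ n\text{ odd}}\frac{p_n}{n}z^n\bigr)$; for $r\ge s\ge0$ let $Q_{(r,s)}=q_rq_s+2\sum_{k=1}^{s}(-1)^kq_{r+k}q_{s-k}$; in general $Q_\lambda$ is the Pfaffian of the antisymmetric matrix with entries $Q_{(\lambda_i,\lambda_j)}$ for $i<j$, where a zero part is appended to $\lambda$ if $\ell(\lambda)$ is odd (so $Q_{(r)}=q_r$, $Q_\varnothing=1$). $\{Q_\lambda:\lambda\in\mathrm{SP}(N)\}$ is a basis of $\Gamma_N$. For an indeterminate $t$, let $\rho_t$ be the algebra automorphism of $\Gamma$ (scalars extended to rational functions in the parameters) with $\rho_t(p_n)=(1-t^n)p_n$ for $n$ odd. For parameters $t,s$ let $T_{t,s}=\rho_s^{-1}\rho_t$, so $T_{t,s}(p_n)=\frac{1-t^n}{1-s^n}p_n$.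 Define $C_{\lambda\mu}(t,s)$, for $\lambda,\mu\in\mathrm{SP}(N)$, by $T_{t,s}Q_\lambda=\sum_{\mu\in\mathrm{SP}(N)}C_{\lambda\mu}(t,s)Q_\mu$ (equivalently, with $\mathcal{Q}_\lambda(X;t)=\rho_tQ_\lambda$ the shifted $t$-Schur functions, $\mathcal{Q}_\lambda(X;t)=\sum_\mu C_{\lambda\mu}(t,s)\mathcal{Q}_\mu(X;s)$), and let $C_N(t,s)=(C_{\lambda\mu}(t,s))_{\lambda,\mu\in\mathrm{SP}(N)}$, rows and columns in the same fixed order. $C_N(t,t)$ means the same with $s=t$. *)

(* Defs.v *)
From HB Require Import structures.
From mathcomp Require Import all_boot all_order all_algebra all_fingroup.
From mathcomp Require Import finmap.
From mathcomp.multinomials Require mpoly monalg.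
From Stdlib Require Import ClassicalEpsilon.

Set Implicit Arguments.
Unset Strict Implicit.
Unset Printing Implicit Defensive.

Import GRing.Theory.

Local Open Scope ring_scope.

(* The names and notations of mpoly clash with those of monalg. *)
Module Params.
Import mpoly.

(* The field Q(X_0, X_1, X_2) of rational functions; [par i] is X_i. *)
Definition Kpar : fieldType := {fraction {mpoly rat[3]}}.

Definition par (i : 'I_3) : Kpar := tofrac 'X_i.

End Params.
Export Params.

Import monalg.

Definition is_strict_part (N : nat) (la : seq nat) : bool :=
  [&& sorted gtn la, 0%N \notin la & sumn la == N].

Record SP (N : nat) := StrictPart {
  parts :> seq nat;
  partsP : is_strict_part N parts
}.

HB.instance Definition _ N := [isSub for @parts N].
HB.instance Definition _ N := [Countable of SP N by <:].

Lemma part_lt N (la : SP N) i : i \in (la : seq nat) -> (i < N.+1)%N.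
Proof.
have /and3P[_ _ /eqP] := partsP la; move: (la : seq nat) => s <-.
elim: s => //= a s IH; rewrite inE => /orP[/eqP ->|/IH]; first by rewrite ltnS leq_addr.
by rewrite !ltnS => h; apply: leq_trans h (leq_addl _ _).
Qed.

(* A strict partition of N is determined by its set of parts, which makes
   SP N a finite type. *)
Definition SP_set N (la : SP N) : {set 'I_N.+1} :=
  [set i : 'I_N.+1 | (i : nat) \in (la : seq nat)].

Definition SP_of_set N (A : {set 'I_N.+1}) : option (SP N) :=
  insub (sort geq (map (@nat_of_ord _) (enum A))).

Lemma SP_setK N : pcancel (@SP_set N) (@SP_of_set N).
Proof.
move=> la; have /and3P[sla _ _] := partsP la; rewrite /SP_of_set.
suff -> : sort geq (map (@nat_of_ord _) (enum (SP_set la))) = val la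
  by rewrite valK.
have tg : transitive geq by move=> a b c ab bc; apply: leq_trans bc ab.
have ag : antisymmetric geq.
  by move=> a b; rewrite /geq /= andbC => /anti_leq.
apply: (sorted_eq tg ag).
- by apply: sort_sorted => a b; apply: leq_total.
- by apply: sub_sorted sla => a b /ltnW.
rewrite perm_sort; apply: uniq_perm.
- by rewrite (map_inj_uniq (@ord_inj _)) enum_uniq.
- have tG : transitive gtn by move=> a b c ab bc; apply: ltn_trans bc ab.
  exact: (sorted_uniq tG (fun x => ltnn x)).
move=> x; apply/mapP/idP => [[i]|xla].
  by rewrite mem_enum inE => h ->.
by exists (Ordinal (part_lt xla)) => //; rewrite mem_enum inE.
Qed.

HB.instance Definition _ N : isFinite (SP N) := PCanIsFinite (@SP_setK N).

Lemma dbl_lt n (i : 'I_n) : (i.*2 < n.*2)%N.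
Proof. by rewrite ltn_double. Qed.

Lemma dblS_lt n (i : 'I_n) : (i.*2.+1 < n.*2)%N.
Proof. by rewrite ltn_Sdouble. Qed.

Definition pfaffian (F : fieldType) (R : comAlgType F) n (A : 'M[R]_(n.*2)) : R :=
  ((2 ^ n * n`!)%N%:R : F)^-1 *:
    \sum_(u : 'S_(n.*2)) (-1) ^+ u *
      \prod_(i < n) A (u (Ordinal (dbl_lt i))) (u (Ordinal (dblS_lt i))).

(* F[p_1, p_3, p_5, ...], meant for F of characteristic 0; the variable of
   index k is p_(2k+1). *)
Notation Gam F := {malg F[{cmonom nat}]}.

Section SchurQ.
Variable F : fieldType.

Definition pw (k : nat) : Gam F := << ucm k >>.

(* [qexp M] is the exponent 2 * \sum_(n odd) p_n / n * z^n up to degree M; it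
   has no constant term, so that the coefficient of z^r in its exponential only
   involves its terms of degree at most r and its powers up to r. *)
Definition qexp (M : nat) : {poly Gam F} :=
  \sum_(k < M | (k.*2.+1 <= M)%N) ((2 / k.*2.+1%:R) *: pw k) *: 'X^(k.*2.+1).

Definition q (r : nat) : Gam F :=
  \sum_(j < r.+1) (j`!%:R : F)^-1 *: (qexp r ^+ j)`_r.

Definition schurQ2 (r s : nat) : Gam F :=
  q r * q s + 2 * \sum_(1 <= k < s.+1) (-1) ^+ k * (q (r + k) * q (s - k)).

(* When the length of la is odd, the appended zero part is the default value
   of [nth]. *)
Definition schurQmx (la : seq nat) : 'M[Gam F]_((uphalf (size la)).*2) :=
  \matrix_(i, j)
    if (i < j)%N then schurQ2 (nth 0%N la i) (nth 0%N la j)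
    else if (j < i)%N then - schurQ2 (nth 0%N la j) (nth 0%N la i)
    else 0.

Definition schurQ (la : seq nat) : Gam F := pfaffian (schurQmx la).

Definition pscale_mon (c : nat -> F) (m : {cmonom nat}) : Gam F :=
  \prod_(k <- finsupp m) (c k *: pw k) ^+ m k.

(* [pscale c] is the F-algebra endomorphism of Gam F sending p_(2k+1) to
   c k *: p_(2k+1): see pscale_pw and pscaleZ. *)
Definition pscale (c : nat -> F) : Gam F -> Gam F :=
  mmap (@mkmalgU {cmonom nat} F mone) (pscale_mon c).

Lemma pscale_mon_mmorphism (c : nat -> F) : mmorphism (pscale_mon c).
Proof.
split=> [m1 m2|]; last by rewrite /pscale_mon mdom1 big_seq_fset0.
have E (d : {fset nat}) (m : {cmonom nat}) : (finsupp m `<=` d)%fset ->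
    pscale_mon c m = \prod_(k <- d) (c k *: pw k) ^+ m k.
  move=> le; apply: big_fset_incl => // k kd.
  by rewrite -cmE_eq0 => /eqP ->; rewrite expr0.
rewrite (E (finsupp m1 `|` finsupp m2)%fset (mmul m1 m2)) ?mdomD //.
rewrite (E (finsupp m1 `|` finsupp m2)%fset m1) ?fsubsetUl //.
rewrite (E (finsupp m1 `|` finsupp m2)%fset m2) ?fsubsetUr //.
by rewrite -big_split /=; apply: eq_bigr => k _; rewrite cmM exprD.
Qed.

HB.instance Definition _ (c : nat -> F) :=
  isMultiplicative.Build {cmonom nat} (Gam F) (pscale_mon c)
    (pscale_mon_mmorphism c).

HB.instance Definition _ (c : nat -> F) := GRing.RMorphism.on (pscale c).

Lemma pscale_pw (c : nat -> F) k : pscale c (pw k) = c k *: pw k.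
Proof.
rewrite /pscale /pw mmapU mul_malgC scale1r /pscale_mon mdomU big_seq_fset1.
by rewrite cmUU expr1.
Qed.

Lemma pscaleZ (c : nat -> F) a f : pscale c (a *: f) = a *: pscale c f.
Proof. by rewrite /pscale mmapZ mul_malgC. Qed.

Lemma pscale_comp (c d : nat -> F) f :
  pscale c (pscale d f) = pscale (fun k => d k * c k) f.
Proof.
rewrite [in RHS]/pscale mmapE.
have -> : pscale d f = \sum_(m <- msupp f) f@_m *: pscale_mon d m.
  by rewrite /pscale mmapE; apply: eq_bigr => m _; rewrite mul_malgC.
rewrite rmorph_sum /=.
apply: eq_bigr => m _; rewrite mul_malgC pscaleZ.
congr (_ *: _). rewrite /pscale_mon rmorph_prod; apply: eq_bigr => k _.
by rewrite rmorphXn /= pscaleZ pscale_pw scalerA.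
Qed.

Lemma mon1 : << mone >> = 1 :> Gam F.
Proof. by apply/malgP => k; rewrite mcoeffU1. Qed.

Lemma monM (k1 k2 : {cmonom nat}) : << k1 >> * << k2 >> = << mmul k1 k2 >> :> Gam F.
Proof. by rewrite (malgMEw msuppU_le msuppU_le) !big_seq_fset1 !mcoeffUU mulr1. Qed.

Lemma monZ (a : F) (m : {cmonom nat}) : a *: << m >> = << a *g m >> :> Gam F.
Proof.
rewrite -mul_malgC (malgMEw msuppU_le msuppU_le) !big_seq_fset1 !mcoeffUU.
by rewrite mulr1 mul1m.
Qed.

Lemma mprod_cmonom (s : seq nat) (m : nat -> nat) :
  \prod_(k <- s) (pw k) ^+ m k
  = << \big[mmul/mone]_(k <- s) iter (m k) (mmul (ucm k)) mone >> :> Gam F.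
Proof.
elim: s => [|a s IH]; first by rewrite !big_nil mon1.
rewrite !big_cons IH -monM; congr (_ * _).
elim: (m a) {IH} => [|n IHn]; first by rewrite expr0 mon1.
by rewrite exprS {}IHn monM.
Qed.

Lemma cmonom_prod (m : {cmonom nat}) :
  \prod_(k <- finsupp m) (pw k) ^+ m k = << m >> :> Gam F.
Proof.
rewrite mprod_cmonom; congr << _ >>; apply/eqP/cmP => i.
have it k n : (iter n (mmul (ucm k)) mone : {cmonom nat}) i = (n * (k == i))%N.
  by elim: n => [|n IH] /=; rewrite ?cm1 ?mul0n // cmM ucmE IH mulSn.
have -> : (\big[mmul/mone]_(k <- finsupp m) iter (m k) (mmul (ucm k)) mone : {cmonom nat}) i
   = (\sum_(k <- finsupp m) m k * (k == i))%N.
  by apply: (big_ind2 (fun (x : {cmonom nat}) y => x i = y)) => [|x1 x2 y1 y2 <- <-|k _]; rewrite ?cm1 ?cmM ?it.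
have [im|im] := boolP (i \in finsupp m).
  rewrite (big_fsetD1 i) //= eqxx muln1 big1_fset ?addn0 // => k.
  by rewrite in_fsetD1 => /andP[/negPf -> _]; rewrite muln0.
rewrite big1_seq => [|k /= km].
  by move: im; rewrite -cmE_eq0 => /eqP.
by case: eqP km im => [-> -> //|]; rewrite muln0.
Qed.

Lemma pscale_id (c : nat -> F) : (forall k, c k = 1) -> pscale c =1 id.
Proof.
move=> c1 f; rewrite /pscale mmapE [RHS]monalgE; apply: eq_bigr => m _.
rewrite mul_malgC.
have -> : pscale_mon c m = << m >>.
  by rewrite -cmonom_prod; apply: eq_bigr => k _; rewrite c1 scale1r.
exact: monZ.
Qed.

Definition rho (t : F) := pscale (fun k => 1 - t ^+ k.*2.+1).

(* The inverse of rho t when t ^+ n != 1 for all odd n: see rhoK and rhoVK. *)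
Definition rhoV (t : F) := pscale (fun k => (1 - t ^+ k.*2.+1)^-1).

Lemma rhoK (t : F) : (forall n, odd n -> 1 - t ^+ n != 0) ->
  cancel (rho t) (rhoV t).
Proof.
move=> nt f; rewrite /rho /rhoV pscale_comp pscale_id // => k.
by rewrite divff // nt //= odd_double.
Qed.

Lemma rhoVK (t : F) : (forall n, odd n -> 1 - t ^+ n != 0) ->
  cancel (rhoV t) (rho t).
Proof.
move=> nt f; rewrite /rho /rhoV pscale_comp pscale_id // => k.
by rewrite mulVf // nt //= odd_double.
Qed.

Definition Tmap (t s : F) (f : Gam F) : Gam F := rhoV s (rho t f).

Definition is_transition N (t s : F) (M : 'M[F]_#|{: SP N}|) : Prop :=
  forall la : SP N,
    Tmap t s (schurQ la) =
    \sum_(mu : SP N) M (enum_rank la) (enum_rank mu) *: schurQ mu.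

(* C_N(t,s), with rows and columns in the order of [enum {: SP N}]. The choice
   operator only selects the matrix of coefficients in the defining expansion:
   it exists and is unique because the Q_la, la in SP(N), form a basis of the
   degree N component, which Tmap t s preserves. *)
Definition Cmx N (t s : F) : 'M[F]_#|{: SP N}| :=
  epsilon (inhabits 0) (@is_transition N t s).

End SchurQ.

(* Main.v *)
(* The Q_la, la in SP(N), form a basis of the degree N component of Gam; hence
   the transition matrices exist and are unique, and the identities express
   T_(s,r) o T_(t,s) = T_(t,r) and T_(t,t) = id.

   Spanning. The series sum_r q_r z^r satisfies q'(z) = E'(z) q(z) with E odd, so
   that q(z) q(-z) = 1 and p_n is a polynomial in the q_r. Filter products of q_r
   by the sum of the squares of the indices. The relation q(z) q(-z) = 1 moves
   q_m^2 up in the filtration, and Q_la is a nonzero multiple of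
   q_(la_1) q_(la_2)... up to higher terms, because the Pfaffian of the matrix
   sgn(j - i) is nonzero.

   Independence. Glaisher's injection of the strict partitions of N into the
   monomials of degree N in p_1, p_3, ...; these monomials are combinations of
   the Q_la, which gives the matrix of coefficients of the Q_la on them an
   inverse. *)

Require Import Defs.
From mathcomp Require Import all_boot all_order all_algebra all_fingroup finmap.
From mathcomp.multinomials Require mpoly monalg.
From mathcomp Require Import zify ring.
From Stdlib Require Import ClassicalEpsilon.

Set Implicit Arguments.
Unset Strict Implicit.
Unset Printing Implicit Defensive.

Import GRing.Theory.
Import monalg.

Local Open Scope ring_scope.

(** * Truncated exponentials and the series of the q_r *)

Section TruncatedExp.
Variables (F : fieldType) (R : comAlgType F).
Hypothesis natF_neq0 : forall n, n.+1%:R != 0 :> F.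
Implicit Types p : {poly R}.

Lemma coef_exp_eq p p' r j :
  (forall i, (i <= r)%N -> p`_i = p'`_i) -> (p ^+ j)`_r = (p' ^+ j)`_r.
Proof.
move=> e; suff: forall i, (i <= r)%N -> (p ^+ j)`_i = (p' ^+ j)`_i by apply.
elim: j => [|j IH] i ir; first by rewrite !expr0.
rewrite !exprS !coefM; apply: eq_bigr => k _; rewrite e ?IH //.
  exact: leq_trans (leq_subr _ _) ir.
by apply: leq_trans ir; rewrite -ltnS.
Qed.

Lemma coef_exp_small p i j : p`_0 = 0 -> (i < j)%N -> (p ^+ j)`_i = 0.
Proof.
move=> p0; elim: j i => // j IH i ij.
rewrite exprS coefM big_ord_recl p0 mul0r add0r big1 // => k _.
by rewrite IH ?mulr0 //= /bump /=; move: (ltn_ord k); lia.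
Qed.

Lemma coefM_small p p' n i :
  (forall j, (j < n)%N -> p`_j = 0) -> (i < n)%N -> (p * p')`_i = 0.
Proof.
move=> p0 lin; rewrite coefM big1 // => k _; rewrite p0 ?mul0r //.
by move: (ltn_ord k); lia.
Qed.

Lemma coef_comp_opprX p i : (p \Po (- 'X))`_i = (-1) ^+ i * p`_i.
Proof.
have E j : ((- 'X : {poly R}) ^+ j)`_i = (-1) ^+ j * (i == j)%:R.
  rewrite [(- 'X) ^+ j]exprNn -[in LHS]signr_odd -[in RHS]signr_odd.
  case: (odd j); rewrite ?expr1 ?expr0 ?mulN1r ?mul1r ?coefN coefXn //.
rewrite coef_comp_poly; under eq_bigr => j _ do rewrite E.
have [lti|gei] := ltnP i (size p).
  rewrite (bigD1 (Ordinal lti)) //= eqxx mulr1 mulrC big1 ?addr0 // => j ji.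
  case: eqP => [ij|_]; last by rewrite !mulr0.
  by move: ji; rewrite -val_eqE /= ij eqxx.
rewrite nth_default // mulr0 big1 // => j _.
by case: eqP (ltn_ord j) => [<-|_ _]; [rewrite ltnNge gei | rewrite !mulr0].
Qed.

(** The exponential of E cut after the power M. Polynomials over R are scaled by R, whence the
    embedding [%:A] of the scalars of F. *)
Definition texp (E : {poly R}) (M : nat) : {poly R} :=
  \sum_(j < M.+1) ((j`!%:R : F)^-1)%:A *: E ^+ j.

Lemma texpS E M :
  texp E M.+1 = texp E M + ((M.+1`!%:R : F)^-1)%:A *: E ^+ M.+1.
Proof. by rewrite /texp big_ord_recr. Qed.

(** Each E^j / j! has derivative E' E^(j-1) / (j-1)!, so Y' = E' Y up to the loss of the top
    power. *)
Lemma deriv_texp E M :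
  (texp E M)^`() =
  E^`() * (texp E M - ((M`!%:R : F)^-1)%:A *: E ^+ M).
Proof.
elim: M => [|M IH].
  by rewrite /texp big_ord_recr big_ord0 /= add0r subrr mulr0 expr0
       derivZ derivC scaler0.
rewrite texpS addrK derivD IH derivZ deriv_exp /= -mulrnAr scalerAr -mulrDr.
congr (_ * _); rewrite -[RHS]addr0 -addrA; congr (_ + _); apply/eqP.
rewrite addrC -scaler_nat scalerA subr_eq0 -(rmorph_nat (in_alg R)) /=.
by rewrite factS natrM invfM -scalerAl mul1r scalerA mulrAC mulVf ?mul1r.
Qed.

End TruncatedExp.

Section QRecursion.
Variable F : fieldType.
Hypothesis natF_neq0 : forall n, n.+1%:R != 0 :> F.

Lemma scaler_divn_mulrn (V : lmodType F) c n (v : V) :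
  ((c / n.+1%:R) *: v) *+ n.+1 = c *: v.
Proof. by rewrite -scaler_nat scalerA mulrCA mulfV ?mulr1. Qed.


Local Notation q := (q F).
Local Notation pw := (pw F).

Lemma coef_qexp M n :
  (qexp F M)`_n = if odd n && (n <= M)%N then (2 / n%:R) *: pw n./2 else 0.
Proof.
rewrite /qexp coef_sum.
have E (k : 'I_M) : (((2 / k.*2.+1%:R) *: pw k) *: 'X^(k.*2.+1) : {poly Gam F})`_n
   = if k.*2.+1 == n then (2 / n%:R) *: pw k else 0.
  by rewrite coefZ coefXn eq_sym; case: eqP => [->|]; rewrite ?mulr1 ?mulr0.
under eq_bigr => k _ do rewrite E.
rewrite -big_mkcondr /=; case: ifP => [/andP[on nM]|nn]; last first.
  by rewrite big1 // => k /andP[k1 /eqP kn]; move: nn; rewrite -kn /= odd_double k1.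
have ltk : (n./2 < M)%N by lia.
rewrite (bigD1 (Ordinal ltk)) /=; last by lia.
rewrite big1 ?addr0 // => k /andP[/andP[_ /eqP kn]]; rewrite -val_eqE /= -kn.
by rewrite /= uphalf_double eqxx.
Qed.

Lemma qexp0 M : (qexp F M)`_0 = 0. Proof. by rewrite coef_qexp. Qed.

(** Powers of [qexp] beyond r start above degree r, and its coefficients up to r do not depend on
    the truncation. A single polynomial thus serves for all q_r with r at most M. *)
Lemma coef_texp_qexp M r : (r <= M)%N -> (texp (qexp F M) M)`_r = q r.
Proof.
move=> rM; rewrite /texp /Defs.q coef_sum.
rewrite (big_ord_widen M.+1 (fun j => (j`!%:R : F)^-1 *: (qexp F r ^+ j)`_r)) //.
rewrite [RHS]big_mkcond; apply: eq_bigr => j _ /=.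
rewrite coefZ mulr_algl; case: ifP => [_|rj].
  congr (_ *: _); apply: coef_exp_eq => i ir; rewrite !coef_qexp ir.
  by rewrite (leq_trans ir rM).
by rewrite coef_exp_small ?scaler0 ?qexp0 // ltnNge -ltnS rj.
Qed.

Lemma q0 : q 0 = 1.
Proof.
rewrite /Defs.q big_ord_recl big_ord0 addr0 expr0 coefC eqxx.
by rewrite invr1 scale1r.
Qed.

Lemma coef_texp_qexp_tail M r : (r < M)%N ->
  (texp (qexp F M) M - ((M`!%:R : F)^-1)%:A *: qexp F M ^+ M)`_r = q r.
Proof.
move=> rM; rewrite coefB coefZ coef_exp_small ?qexp0 // mulr0 subr0.
exact: coef_texp_qexp (ltnW rM).
Qed.

(** The coefficient of z^r in q' = E' q, where E' is twice the sum of p_(i+1) z^i over even i. The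
    correction in E^(r+1) starts above degree r. *)
Lemma q_rec r : (r.+1)%:R *: q r.+1 =
  \sum_(i < r.+1) (if odd i then 0 else 2 *: pw i./2) * q (r - i).
Proof.
have := coef_deriv (texp (qexp F r.+1) r.+1) r.
rewrite deriv_texp // coef_texp_qexp // scaler_nat => <-.
rewrite coefM; apply: eq_bigr => i _; rewrite coef_texp_qexp_tail; last lia.
congr (_ * _); rewrite coef_deriv coef_qexp /= ltn_ord andbT.
case oi: (odd i) => /=; first by rewrite mul0rn.
by rewrite uphalf_half oi scaler_divn_mulrn.
Qed.

(** This is q(-z) q(z) = 1 in degree n. As E is odd, the derivative of Y(-z) Y(z) is a multiple of
    E^M and vanishes below degree M. *)
Lemma q_conv n : (0 < n)%N -> \sum_(i < n.+1) (-1) ^+ i * (q i * q (n - i)) = 0.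
Proof.
case: n => // n _.
set M := n.+1; set E := qexp F M; set Y := texp E M.
set c := ((M`!%:R : F)^-1)%:A : Gam F.
have Eopp : E \Po (- 'X) = - E.
  apply/polyP => i; rewrite coef_comp_opprX coefN coef_qexp -signr_odd.
  by case: (odd i); rewrite ?expr1 ?mulN1r //= mulr0 oppr0.
have E'opp : E^`() \Po (- 'X) = E^`().
  apply/polyP => i; rewrite coef_comp_opprX !coef_deriv coef_qexp -signr_odd /=.
  by case: (odd i) => /=; rewrite ?mul0rn ?mulr0 ?expr0 ?mul1r.
have dY : Y^`() = E^`() * (Y - c *: E ^+ M) := deriv_texp natF_neq0 _ _.
pose G := (Y \Po (- 'X)) * Y.
(* The two terms E' Y(-z) Y(z) cancel because E' is even; only the truncation corrections remain. *)
have dG : G^`() = E ^+ M * (E^`() * (((-1) ^+ M * Y - (Y \Po - 'X)) * c%:P)).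
  rewrite derivM deriv_comp dY derivN derivX comp_polyM E'opp comp_polyB comp_polyZ.
  rewrite rmorphXn /= Eopp -!mul_polyC [(- E) ^+ M]exprNn.
  by set Ym := Y \Po _; ring.
have : G^`()`_n = 0.
  rewrite dG (@coefM_small _ _ _ _ M) // => j jM.
  by rewrite coef_exp_small ?qexp0.
rewrite coef_deriv -[LHS](@scaler_nat F) => GM0.
have {GM0} : G`_M = 0 by apply: (scalerI (natF_neq0 n)); rewrite GM0 scaler0.
rewrite /G coefM => GM0; rewrite -[RHS]GM0; apply: eq_bigr => i _.
have iM : (i <= M)%N by rewrite -ltnS.
rewrite coef_comp_opprX (coef_texp_qexp iM) (coef_texp_qexp (leq_subr i M)).
exact: mulrA.
Qed.

End QRecursion.

(** * The sign sum of the Pfaffian *)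

Section PfaffianSigns.
Variable n : nat.
Definition ev (i : 'I_n) : 'I_n.*2 := Ordinal (dbl_lt i).
Definition od (i : 'I_n) : 'I_n.*2 := Ordinal (dblS_lt i).
Implicit Types (u : 'S_(n.*2)) (i j : 'I_n) (x y : 'I_n.*2).

Definition cmp_sign (a b : nat) : int :=
  if (a < b)%N then 1 else if (b < a)%N then -1 else 0.

(** The term of u in the Pfaffian sum of the matrix sgn(j - i). *)
Definition pf_sign u : int :=
  (-1) ^+ u * \prod_i cmp_sign (u (ev i)) (u (od i)).

Lemma half_lt x : (x./2 < n)%N. Proof. by have := ltn_ord x; lia. Qed.

Definition block x : 'I_n := Ordinal (half_lt x).

Variant block_spec x : Prop :=
| BlockEven i of x = ev i
| BlockOdd i of x = od i.

Lemma blockP x : block_spec x.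
Proof.
case ox: (odd x).
  by apply: (@BlockOdd x (block x)); apply/val_inj => /=; lia.
by apply: (@BlockEven x (block x)); apply/val_inj => /=; lia.
Qed.

Lemma block_ev i : block (ev i) = i.
Proof. by apply/val_inj; rewrite /= doubleK. Qed.

Lemma block_od i : block (od i) = i.
Proof. by apply/val_inj => /=; lia. Qed.

Lemma ev_neq_od i j : ev i != od j.
Proof. by rewrite -val_eqE /=; lia. Qed.

(** The values 2i and 2i + 1 stand at the two positions of one block, hence are compared with each
    other. *)
Definition matched u i := block ((u^-1)%g (ev i)) == block ((u^-1)%g (od i)).

(** No integer lies between 2i and 2i + 1, so their exchange affects only their own comparison. *)
Lemma cmp_sign_tperm i x y :
  ~ (x = ev i /\ y = od i) -> ~ (x = od i /\ y = ev i) ->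
  cmp_sign (tperm (ev i) (od i) x) (tperm (ev i) (od i) y) = cmp_sign x y.
Proof.
move=> n1 n2; rewrite /cmp_sign.
have V (z z' : 'I_n.*2) : z <> z' -> (z : nat) <> z' by move=> d e; apply/d/val_inj.
case: tpermP n1 n2 => [->|->|/V /= a1 /V /= a2];
  case: tpermP => [->|->|/V /= b1 /V /= b2] n1 n2 //=.
all: try by [case: n1|case: n2].
all: rewrite ?ltnn //.
all: by repeat case: ltnP => ? //; lia.
Qed.

Lemma pf_sign_tperm u i : ~~ matched u i ->
  pf_sign (u * tperm (ev i) (od i))%g = - pf_sign u.
Proof.
move=> nm; rewrite /pf_sign odd_permM odd_tperm ev_neq_od addbT signrN mulNr.
congr (- (_ * _)); apply: eq_bigr => j _; rewrite !permM cmp_sign_tperm //.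
  case=> a b; case/negP: nm; rewrite /matched -a -b !permK.
  by rewrite block_ev block_od.
case=> a b; case/negP: nm; rewrite /matched -a -b !permK.
by rewrite block_ev block_od.
Qed.

Lemma matched_tperm u i j : matched (u * tperm (ev i) (od i))%g j = matched u j.
Proof.
rewrite /matched invMg tpermV !permM; have [->|ji] := eqVneq j i.
  by rewrite tpermL tpermR eq_sym.
have nij: (i : nat) != j by rewrite val_eqE eq_sym.
by rewrite !tpermD // -val_eqE /=; lia.
Qed.

(* Exchanging the values 2i and 2i + 1 flips the sign of a term unless u pairs
   these two values. *)
Lemma sum_pf_sign_matched :
  \sum_u pf_sign u = \sum_(u | [forall i, matched u i]) pf_sign u.
Proof.
(* The condition is imposed on one pair of values after another, so that each cancellation uses a
   single transposition. *)
suff E k : (k <= n)%N ->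
    \sum_u pf_sign u =
    \sum_(u | [forall i : 'I_n, (i < k)%N ==> matched u i]) pf_sign u.
  rewrite (E n) //; apply: eq_bigl => u; apply: eq_forallb => i.
  by rewrite ltn_ord.
elim: k => [_|k IH kn].
  by apply: eq_bigl => u; apply/esym/forallP.
rewrite {}IH ?(ltnW kn) //.
have [i0 i0k] : exists i0 : 'I_n, i0 = k :> nat by exists (Ordinal kn).
rewrite (bigID (fun u => matched u i0)) /= [X in _ + X](_ : _ = 0) ?addr0.
  apply: eq_bigl => u; apply/andP/forallP => [[/forallP m m0] i|m].
    rewrite ltnS leq_eqVlt; apply/implyP => /orP[/eqP ik|ik].
      by rewrite (_ : i = i0) //; apply/val_inj; rewrite /= i0k.
    exact: (implyP (m i)).
  split; last by apply: (implyP (m i0)); rewrite i0k.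
  by apply/forallP => i; apply/implyP => ik; apply: (implyP (m i)); apply: ltnW.
set S := \sum_(_ | _) _; suff: S = - S by lia.
rewrite {1}/S (reindex_inj (mulIg (tperm (ev i0) (od i0)))) /= /S -sumrN.
apply: eq_big => [u|u /andP[_]]; rewrite !matched_tperm.
  by congr (_ && _); apply: eq_forallb => i; rewrite matched_tperm.
exact: pf_sign_tperm.
Qed.

(** Turns the condition on values into one on positions: the partner of the value u(2j) also sits in
    block j, and by injectivity only at 2j + 1. *)
Lemma matched_block u : [forall i, matched u i] ->
  forall j, block (u (ev j)) = block (u (od j)).
Proof.
move=> /forallP m j; set x := u (ev j).
have ux : (u^-1)%g x = ev j by rewrite /x permK.
clearbody x; case: (blockP x) ux (m (block x)) => i -> ux;
  rewrite /matched ?block_ev ?block_od ux.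
  case: (blockP ((u^-1)%g (od i))) => k e; rewrite e ?block_ev ?block_od => /eqP jk.
    by move: (ev_neq_od i i); rewrite -(inj_eq (@perm_inj _ u^-1%g)) ux e jk eqxx.
  by rewrite jk -e permKV block_od.
rewrite eq_sym.
case: (blockP ((u^-1)%g (ev i))) => k e; rewrite e ?block_ev ?block_od => /eqP jk.
  by move: (ev_neq_od i i); rewrite -(inj_eq (@perm_inj _ u^-1%g)) ux e jk eqxx.
by rewrite jk -e permKV block_ev.
Qed.

(* u is the product of a permutation of the even positions and of its conjugate
   by the exchange of each 2i with 2i + 1. *)
Lemma perm_of_blocks_even u (f : 'I_n -> 'I_n) :
  (forall i, u (ev i) = ev (f i)) -> (forall i, u (od i) = od (f i)) ->
  u = false :> bool.
Proof.
move=> ue uo.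
have f_inj : injective f.
  move=> i j ij; have /perm_inj/(congr1 block) : u (ev i) = u (ev j) by rewrite !ue ij.
  by rewrite !block_ev.
pose g x := if odd x then x else ev (f (block x)).
have ge i : g (ev i) = ev (f i) by rewrite /g /= odd_double block_ev.
have go i : g (od i) = od i by rewrite /g /= odd_double.
have g_inj : injective g.
  move=> x y; case: (blockP x) => i ->; case: (blockP y) => j ->.
  - by rewrite !ge => /(congr1 block); rewrite !block_ev => /f_inj ->.
  - by rewrite ge go => /eqP; rewrite (negbTE (ev_neq_od _ _)).
  - by rewrite ge go => /eqP; rewrite eq_sym (negbTE (ev_neq_od _ _)).
  by rewrite !go.
pose c x := if odd x then ev (block x) else od (block x).
have ce i : c (ev i) = od i by rewrite /c /= odd_double block_ev.
have co i : c (od i) = ev i by rewrite /c /= odd_double block_od.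
have c_inj : injective c.
  by apply: (can_inj (g := c)) => x; case: (blockP x) => i ->; rewrite ?(ce, co).
pose E := perm g_inj; pose C := perm c_inj.
have CV x : (C^-1)%g (c x) = x by rewrite -[c x](permE c_inj) permK.
(* A permutation and its conjugate have equal parity. *)
suff -> : u = (E * (E ^ C))%g by rewrite odd_permM odd_permJ addbb.
apply/permP => x; rewrite conjgE !permM [E x]permE.
case: (blockP x) => i ->; rewrite ?ge ?go ?ue ?uo.
  by rewrite -[ev (f i)]co CV !permE go co.
by rewrite -[od i]ce CV !permE ge ce.
Qed.

(** Exchanging the two positions of a block flips both the signature and the factor of that
    block. *)
Lemma pf_sign_tpermM u i :
  pf_sign (tperm (ev i) (od i) * u)%g = pf_sign u.
Proof.
rewrite /pf_sign odd_mul_tperm ev_neq_od addTb signrN mulNr -mulrN.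
congr (_ * _); rewrite (bigD1 i) //= [in RHS](bigD1 i) //= !permM tpermL tpermR.
rewrite -mulNr; congr (_ * _).
  by rewrite /cmp_sign; case: ltngtP.
apply: eq_bigr => j ji; rewrite !permM.
have ij: (i : nat) != j by rewrite val_eqE eq_sym.
by rewrite !tpermD // -val_eqE /=; lia.
Qed.

(** Induction on the number of blocks with a descent, each removable without changing the term.
    Without descents u permutes whole blocks, so it is even and all factors are 1. *)
Lemma pf_sign_matched u : [forall i, matched u i] -> pf_sign u = 1.
Proof.
move/matched_block => bl.
have [k] := ubnP #|[set i | (u (od i) < u (ev i))%N]|.
elim: k u bl => // k IH u bl lt.
have [i /= iP|none] := pickP [pred i | (u (od i) < u (ev i))%N].
  rewrite -(pf_sign_tpermM u i); apply: IH => [j|].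
    rewrite !permM; have [->|ji] := eqVneq j i; first by rewrite tpermL tpermR bl.
    have ij: (i : nat) != j by rewrite val_eqE eq_sym.
    by rewrite !tpermD ?bl // -val_eqE /=; lia.
  apply: leq_trans (_ : #|[set i | (u (od i) < u (ev i))%N] :\ i| < k)%N; last first.
    by move: lt; rewrite (cardsD1 i) inE iP.
  rewrite ltnS; apply: subset_leq_card; apply/subsetP => j; rewrite !inE !permM.
  have [->|ji] := eqVneq j i.
    by rewrite tpermL tpermR ltnNge ltnW.
  have ij: (i : nat) != j by rewrite val_eqE eq_sym.
  by rewrite !tpermD // -val_eqE /=; lia.
have ueo i : u (ev i) = ev (block (u (ev i))) /\ u (od i) = od (block (u (ev i))).
  have := bl i; have := none i; rewrite /=.
  have : u (ev i) != u (od i) by rewrite (inj_eq perm_inj) ev_neq_od.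
  (* Of the four parity patterns, only even followed by odd is injective and free of descents. *)
  case: (blockP (u (ev i))) => a ->; case: (blockP (u (od i))) => b ->;
    rewrite ?block_ev ?block_od => ne lab ab; rewrite ab in ne lab *.
  - by rewrite eqxx in ne.
  - by [].
  - by move: lab => /=; lia.
  by rewrite eqxx in ne.
rewrite /pf_sign (@perm_of_blocks_even u (fun i => block (u (ev i)))) => [|i|i].
- rewrite mul1r big1 // => i _; rewrite /cmp_sign.
  by case: (ueo i) => -> ->; rewrite block_ev /= ltnSn.
- by case: (ueo i).
by case: (ueo i).
Qed.

(** The sum counts the matched permutations, and the identity is one of them. *)
Lemma sum_pf_sign_gt0 : exists k : nat, \sum_u pf_sign u = k.+1%:R.
Proof.
rewrite sum_pf_sign_matched (eq_bigr (fun=> 1)); last exact: pf_sign_matched.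
rewrite sumr_const; exists #|[pred u | [forall i, matched u i]]|.-1.
rewrite prednK //; apply/card_gt0P; exists 1%g; rewrite inE.
by apply/forallP => i; rewrite /matched invg1 !perm1 block_ev block_od.
Qed.

End PfaffianSigns.

(** * Linear spans and the filtration by sums of squares *)

Section LinearSpan.
Variables (F : fieldType) (V : lmodType F).

(** An inductive form of the span allows infinitely many generators and gives induction along a
    linear combination. *)
Inductive lspan (P : V -> Prop) : V -> Prop :=
| LSpan0 : lspan P 0
| LSpanS a f g of P f & lspan P g : lspan P (a *: f + g).

Implicit Types P Q : V -> Prop.

Lemma lspan_gen P f : P f -> lspan P f.
Proof. by move=> Pf; rewrite -[f]scale1r -[_ *: f]addr0; apply/LSpanS/LSpan0. Qed.

Lemma lspanD P f g : lspan P f -> lspan P g -> lspan P (f + g).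
Proof. by elim=> [|a h k Ph _ IH] Pg; rewrite ?add0r // -addrA; apply/LSpanS/IH. Qed.

Lemma lspanZ P a f : lspan P f -> lspan P (a *: f).
Proof.
elim=> [|b h k Ph _ IH]; first by rewrite scaler0; apply: LSpan0.
by rewrite scalerDr scalerA; apply: LSpanS.
Qed.

Lemma lspanN P f : lspan P f -> lspan P (- f).
Proof. by rewrite -scaleN1r; apply: lspanZ. Qed.

Lemma lspanB P f g : lspan P f -> lspan P g -> lspan P (f - g).
Proof. by move=> Pf Pg; apply/lspanD/lspanN. Qed.

Lemma lspan_sum P (I : Type) (r : seq I) (p : pred I) (f : I -> V) :
  (forall i, p i -> lspan P (f i)) -> lspan P (\sum_(i <- r | p i) f i).
Proof. by move=> Pf; elim/big_ind: _ => //; [apply: LSpan0 | apply: lspanD]. Qed.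

Lemma lspan_sub P Q f :
  (forall g, P g -> lspan Q g) -> lspan P f -> lspan Q f.
Proof.
move=> PQ; elim=> [|a g h Pg _ IH]; first exact: LSpan0.
by apply/lspanD/IH/lspanZ/PQ.
Qed.

Lemma lspan_fin (I : finType) (e : I -> V) f :
  lspan (fun g => exists i, g = e i) f -> exists c : I -> F, f = \sum_i c i *: e i.
Proof.
elim=> [|a _ _ [i ->] _ [c ->]].
  by exists (fun=> 0); rewrite big1 // => i _; rewrite scale0r.
exists (fun j => (if j == i then a else 0) + c j).
under [RHS]eq_bigr => j _ do rewrite scalerDl.
rewrite big_split; congr (_ + _); rewrite (bigD1 i) //= eqxx big1 ?addr0 //.
by move=> j /negbTE ->; rewrite scale0r.
Qed.

End LinearSpan.

Section AlgebraSpan.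
Variables (F : fieldType) (R : comAlgType F).

Lemma lspanM (P Q S : R -> Prop) f g :
  (forall h k, P h -> Q k -> lspan S (h * k)) ->
  lspan P f -> lspan Q g -> lspan S (f * g).
Proof.
move=> PQ; elim=> [|a h k Ph _ IH] Qg; first by rewrite mul0r; apply: LSpan0.
rewrite mulrDl -scalerAl; apply/lspanD/IH => //; apply: lspanZ.
elim: Qg => [|b h' k' Qh _ IH']; first by rewrite mulr0; apply: LSpan0.
by rewrite mulrDr -scalerAr; apply/lspanD/IH'/lspanZ/PQ.
Qed.

Lemma lspan_signM (P : R -> Prop) k f : lspan P f -> lspan P ((-1) ^+ k * f).
Proof.
move=> Pf; rewrite -signr_odd; case: (odd k); rewrite ?expr1 ?mulN1r ?expr0 ?mul1r //.
exact: lspanN.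
Qed.

End AlgebraSpan.

Section QSpan.
Variable F : fieldType.
Hypothesis natF_neq0 : forall n, n.+1%:R != 0 :> F.

Local Notation q := (q F).

(** Any order of the indices and zeros among them are allowed; q_0 = 1 adds nothing to either
    sum. *)
Definition qgen (N d : nat) (f : Gam F) : Prop :=
  exists mu : seq nat, [/\ (\sum_(i <- mu) i = N)%N, (d <= \sum_(i <- mu) i ^ 2)%N
    & f = \prod_(i <- mu) q i].

(* The filtration by the sum of the squares of the indices: raising operators
   (r, s) -> (r + k, s - k) with r >= s strictly increase it. *)
Definition qspan N d := lspan (qgen N d).

Lemma qspan_prod mu : qspan (\sum_(i <- mu) i) (\sum_(i <- mu) i ^ 2)
  (\prod_(i <- mu) q i).
Proof. by apply: lspan_gen; exists mu. Qed.

Lemma qspan_le N d d' f : (d' <= d)%N -> qspan N d f -> qspan N d' f.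
Proof.
move=> dd; apply: lspan_sub => _ [mu [muN mud ->]]; apply: lspan_gen.
by exists mu; split=> //; apply: leq_trans mud.
Qed.

Lemma qspanM N d f M e g :
  qspan N d f -> qspan M e g -> qspan (N + M) (d + e) (f * g).
Proof.
apply: lspanM => _ _ [mu [<- mud ->]] [nu [<- nue ->]]; apply: lspan_gen.
by exists (mu ++ nu); rewrite !big_cat /=; split=> //; apply: leq_add.
Qed.

Lemma qspan1 : qspan 0 0 1.
Proof. by have := qspan_prod [::]; rewrite !big_nil. Qed.

Lemma qspan_q r : qspan r (r ^ 2) (q r).
Proof. by have := qspan_prod [:: r]; rewrite !big_seq1. Qed.

Lemma qspan_qq N d a b : (a + b = N)%N -> (d <= a ^ 2 + b ^ 2)%N ->
  qspan N d (q a * q b).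
Proof. by move=> <- le; apply: qspan_le le (qspanM (qspan_q a) (qspan_q b)). Qed.

(** For a >= b and k >= 1, the indices a + k and b - k have a larger sum of squares than a and b. *)
Lemma schurQ2_lead a b : (b <= a)%N ->
  qspan (a + b) (a ^ 2 + b ^ 2).+1 (schurQ2 F a b - q a * q b).
Proof.
move=> ba; rewrite /schurQ2 addrAC subrr add0r mulr_natl mulr2n.
suff S : qspan (a + b) (a ^ 2 + b ^ 2).+1
   (\sum_(1 <= k < b.+1) (-1) ^+ k * (q (a + k) * q (b - k))) by apply: lspanD.
rewrite big_seq; apply: lspan_sum => k; rewrite mem_index_iota => /andP[k1 kb].
by apply/lspan_signM/qspan_qq; [lia | nia].
Qed.

(** In the relation q(-z) q(z) = 1 in degree 2m, the middle term is q_m^2 up to sign; any other two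
    indices of sum 2m have a larger sum of squares. *)
Lemma q_sqr m : (0 < m)%N -> qspan m.*2 (m ^ 2 + m ^ 2).+1 (q m * q m).
Proof.
move=> m0; have lt : (m < m.*2.+1)%N by lia.
have c0 : (0 < m.*2)%N by lia.
have := q_conv natF_neq0 c0; rewrite (bigD1 (Ordinal lt)) //=.
rewrite (_ : m.*2 - m = m)%N; last by lia.
move/eqP; rewrite addr_eq0 => /eqP E.
have -> : q m * q m = (-1) ^+ m * ((-1) ^+ m * (q m * q m)).
  by rewrite signrMK.
apply: lspan_signM; rewrite E; apply/lspanN/lspan_sum => i im.
have {}im : (i : nat) <> m by move=> im'; case/eqP: im; apply/val_inj.
by apply/lspan_signM/qspan_qq; move: (ltn_ord i); [lia | nia].
Qed.

(** Leading terms multiply: factors are replaced one at a time, each replacement costing only higher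
    terms. *)
Lemma qspan_prod_lead (I : Type) (r : seq I) (f g : I -> Gam F) (N d : I -> nat) :
  (forall i, qspan (N i) (d i) (g i)) ->
  (forall i, qspan (N i) (d i).+1 (f i - g i)) ->
  qspan (\sum_(i <- r) N i) (\sum_(i <- r) d i).+1
    (\prod_(i <- r) f i - \prod_(i <- r) g i).
Proof.
move=> gP fgP; elim: r => [|i r IH]; first by rewrite !big_nil subrr; apply: LSpan0.
rewrite !big_cons; set f' := \prod_(_ <- r) f _; set g' := \prod_(_ <- r) g _.
have g'P : qspan (\sum_(i <- r) N i) (\sum_(i <- r) d i) g'.
  rewrite /g'; elim: (r) => [|j s IHs]; first by rewrite !big_nil; apply: qspan1.
  by rewrite !big_cons; apply: qspanM.
have f'P : qspan (\sum_(i <- r) N i) (\sum_(i <- r) d i) f'.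
  by rewrite -[f'](subrK g'); apply/lspanD/g'P; apply: qspan_le IH.
have -> : f i * f' - g i * g' = (f i - g i) * f' + g i * (f' - g') by ring.
by apply: lspanD; [rewrite -addSn | rewrite -addnS]; apply: qspanM.
Qed.

End QSpan.

(** * Leading term of Q_la *)

Section BigPairs.
Variables (R : Type) (idx : R) (op : Monoid.com_law idx).

Lemma big_ord_pairs n (f : 'I_n.*2 -> R) :
  \big[op/idx]_j f j = \big[op/idx]_(i < n) op (f (ev i)) (f (od i)).
Proof.
elim: n f => [|n IH] f; first by rewrite !big_ord0.
rewrite [RHS]big_ord_recr /= (big_ord_recr n.*2.+1) (big_ord_recr n.*2) /= IH.
rewrite -Monoid.mulmA; congr (op _ (op _ _)); last 2 first.
- by congr f; apply/val_inj.
- by congr f; apply/val_inj.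
by apply: eq_bigr => i _; congr (op (f _) (f _)); apply/val_inj.
Qed.

(** Lets the zero part appended in odd length disappear from products and sums. *)
Lemma big_ord_nth0 m (s : seq nat) (g : nat -> R) : (size s <= m)%N -> g 0%N = idx ->
  \big[op/idx]_(i < m) g (nth 0%N s i) = \big[op/idx]_(i <- s) g i.
Proof.
move=> sm g0; rewrite (big_nth 0%N) big_mkord.
rewrite (big_ord_widen m (fun i => g (nth 0%N s i)) sm) [RHS]big_mkcond.
apply: eq_bigr => i _; case: ltnP => // si.
by rewrite nth_default.
Qed.

End BigPairs.

Section SchurQLead.
Variable F : fieldType.
Hypothesis natF_neq0 : forall n, n.+1%:R != 0 :> F.

Local Notation q := (q F).

Lemma schurQmx_lead (la : seq nat) (a b : 'I_(uphalf (size la)).*2) :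
  sorted geq la -> a != b ->
  qspan (nth 0%N la a + nth 0%N la b)%N (nth 0%N la a ^ 2 + nth 0%N la b ^ 2)%N.+1
    (schurQmx F la a b -
     (cmp_sign a b)%:~R *: (q (nth 0%N la a) * q (nth 0%N la b))).
Proof.
move=> sla ab; have nth_le i j : (i < j)%N -> (nth 0 la j <= nth 0 la i)%N.
  move=> ij; have [lej|ltj] := leqP (size la) j; first by rewrite nth_default.
  have tg : transitive geq by move=> x y z xy yz; apply: leq_trans yz xy.
  by apply: (sorted_ltn_nth tg 0%N sla) => //; apply: ltn_trans ltj.
rewrite mxE /cmp_sign; case: ltngtP => [lt|lt|/val_inj e]; last by rewrite e eqxx in ab.
  by rewrite rmorph1 scale1r; apply/schurQ2_lead/nth_le.
rewrite rmorphN rmorph1 scaleN1r -opprD; apply: lspanN.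
by rewrite mulrC addnC [(_ ^ 2 + _)%N]addnC; apply/schurQ2_lead/nth_le.
Qed.

(** With every entry replaced by its leading term, each term of the Pfaffian is the full product of
    the q_(la_i) times a sign, and these signs have a nonzero sum. *)
Lemma schurQ_lead (la : seq nat) : sorted geq la ->
  exists2 c : F, c != 0 &
    qspan (\sum_(i <- la) i) (\sum_(i <- la) i ^ 2).+1
      (schurQ F la - c *: \prod_(i <- la) q i).
Proof.
move=> sla; set n := uphalf (size la).
have [k Ek] := sum_pf_sign_gt0 n.
have c'0 : ((2 ^ n * n`!)%N%:R : F)^-1 != 0.
  by rewrite invr_eq0 -(prednK (_ : 0 < 2 ^ n * n`!)%N) ?natF_neq0 //
       muln_gt0 expn_gt0 fact_gt0.
(* The constant is the Pfaffian of the matrix sgn(j - i). *)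
exists (((2 ^ n * n`!)%N%:R : F)^-1 * k.+1%:R); first by rewrite mulf_neq0.
have sn : (size la <= n.*2)%N by rewrite /n; lia.
have prodE : \prod_(j < n.*2) q (nth 0%N la j) = \prod_(i <- la) q i.
  by apply: big_ord_nth0 => //; apply: q0.
have sumE : (\sum_(j < n.*2) nth 0 la j = \sum_(i <- la) i)%N.
  by apply: (big_ord_nth0 _ (g := id)).
have sqE : (\sum_(j < n.*2) nth 0 la j ^ 2 = \sum_(i <- la) i ^ 2)%N.
  by apply: (big_ord_nth0 _ (g := fun x => x ^ 2)%N).
rewrite /schurQ /pfaffian -/n -scalerA -scalerBr; apply: lspanZ.
have <- : (\sum_u @pf_sign n u)%:~R *: \prod_(i <- la) q i =
    k.+1%:R *: \prod_(i <- la) q i.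
  by rewrite Ek natz pmulrn.
rewrite rmorph_sum scaler_suml -sumrB; apply: lspan_sum => u _.
rewrite /pf_sign rmorphM rmorphXn rmorphN rmorph1 rmorph_prod /=.
(* A permutation lists every position once, so a product over all positions regroups along its
   pairs. *)
have permE (T : Type) (idx : T) (op : Monoid.com_law idx) (f : 'I_n.*2 -> T) :
    \big[op/idx]_j f j = \big[op/idx]_(i < n) op (f (u (ev i))) (f (u (od i))).
  by rewrite (reindex_inj (@perm_inj _ u)) big_ord_pairs.
have -> : ((-1) ^+ u * \prod_(i < n) (cmp_sign (u (ev i)) (u (od i)))%:~R) *:
    \prod_(i <- la) q i
  = (-1) ^+ u * \prod_(i < n) ((cmp_sign (u (ev i)) (u (od i)))%:~R *:
     (q (nth 0%N la (u (ev i))) * q (nth 0%N la (u (od i))))).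
  rewrite scaler_prod -prodE permE -scalerA.
  by case: (odd_perm u) => /=; rewrite ?expr1 ?expr0 ?scale1r ?scaleN1r ?mul1r ?mulN1r.
rewrite -mulrBr; apply: lspan_signM.
rewrite -sumE -sqE (permE _ _ _ (fun j => nth 0 la j)%N)
  (permE _ _ _ (fun j => nth 0 la j ^ 2)%N).
apply: qspan_prod_lead => i; last first.
  apply: schurQmx_lead => //.
  by rewrite (inj_eq perm_inj) ev_neq_od.
by apply/lspanZ/qspan_qq.
Qed.

End SchurQLead.

(** * The Q_la span each degree *)

Lemma big_sort_pos (R : Type) (idx : R) (op : Monoid.com_law idx) (g : nat -> R)
    (mu : seq nat) : g 0%N = idx ->
  \big[op/idx]_(i <- sort geq [seq i <- mu | (0 < i)%N]) g i =
  \big[op/idx]_(i <- mu) g i.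
Proof.
move=> g0; rewrite (perm_big [seq i <- mu | (0 < i)%N]) ?perm_sort //=.
by rewrite big_filter big_mkcond; apply: eq_bigr => -[|i] _ /=.
Qed.

Lemma not_uniq_perm (T : eqType) (s : seq T) :
  ~~ uniq s -> exists x s', perm_eq s [:: x, x & s'].
Proof.
elim: s => //= a s IH; rewrite negb_and negbK => /orP[as_|/IH[x [s' ss']]].
  by exists a, (rem a s); rewrite perm_cons perm_to_rem.
exists x, (a :: s'); apply: perm_trans (permEl (perm_catCA [:: a] [:: x; x] s')).
by rewrite perm_cons.
Qed.

Lemma sum_sqr_le (s : seq nat) : (\sum_(i <- s) i ^ 2 <= (\sum_(i <- s) i) ^ 2)%N.
Proof.
elim: s => [|a s IH]; first by rewrite !big_nil.
by rewrite !big_cons; nia.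
Qed.

Lemma scaler_inv_subK (F : fieldType) (V : lmodType F) (c : F) (v w : V) :
  c != 0 -> v = c^-1 *: w - c^-1 *: (w - c *: v).
Proof. by move=> c0; rewrite scalerBr scalerK // subKr. Qed.

Section SchurQSpanning.
Variable F : fieldType.
Hypothesis natF_neq0 : forall n, n.+1%:R != 0 :> F.

Local Notation q := (q F).
Local Notation pw := (pw F).

Definition Qspan N := lspan (fun g => exists la : SP N, g = schurQ F la).

(** Descending induction on d, which cannot exceed N^2 for a generator. Distinct indices give a
    multiple of some Q_la plus higher terms; a repeated index moves the product up. *)
Lemma qspan_Qspan N d f : qspan N d f -> Qspan N f.
Proof.
have [k] := ubnP (N ^ 2 + 1 - d)%N; elim: k d f => // k IH d f dk.
apply: lspan_sub => _ [mu [muN mud ->]].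
have dN : (d <= N ^ 2)%N by rewrite -muN; apply: leq_trans mud (sum_sqr_le _).
have IH' g : qspan N d.+1 g -> Qspan N g by apply: IH; lia.
set nu := sort geq [seq i <- mu | (0 < i)%N].
have nuN : (\sum_(i <- nu) i = N)%N by rewrite (big_sort_pos _ (g := id)).
have nud : (d <= \sum_(i <- nu) i ^ 2)%N
  by rewrite (big_sort_pos _ (g := fun i => i ^ 2)%N).
have snu : sorted geq nu by apply: sort_sorted => a b; apply: leq_total.
have nu0 : 0%N \notin nu by rewrite mem_sort mem_filter.
rewrite -(@big_sort_pos _ _ _ q); last exact: q0.
rewrite -/nu; move: nu nuN nud snu nu0 => {mu muN mud} nu nuN nud snu nu0.
have [u|/not_uniq_perm[m [s Es]]] := boolP (uniq nu).
  have pnu : is_strict_part N nu.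
    by rewrite /is_strict_part nu0 sumnE nuN eqxx !andbT gtn_sorted_uniq_geq u.
  have [c c0 lead] := schurQ_lead natF_neq0 snu.
  have -> : \prod_(i <- nu) q i = c^-1 *: schurQ F nu -
      c^-1 *: (schurQ F nu - c *: \prod_(i <- nu) q i).
    exact: scaler_inv_subK.
  apply: lspanB; first by apply/lspanZ/lspan_gen; exists (StrictPart pnu).
  by apply/lspanZ/IH'; rewrite -nuN; apply: qspan_le lead.
have m0 : (0 < m)%N.
  by case: m Es => // Es; rewrite (perm_mem Es) inE in nu0.
apply: IH'; rewrite (perm_big _ Es) !big_cons /= mulrA.
rewrite -nuN (perm_big _ Es) !big_cons /= addnA addnn.
apply: qspan_le (qspanM (q_sqr natF_neq0 m0) (qspan_prod F s)).
by move: nud; rewrite (perm_big _ Es) !big_cons /=; lia.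
Qed.

(** The component of degree N, spanned by monomials; the index k has degree 2k + 1. *)
Definition pspan N := lspan (fun f : Gam F =>
  exists2 s : seq nat, (\sum_(k <- s) k.*2.+1 = N)%N & f = \prod_(k <- s) pw k).

Lemma pspanM N M f g : pspan N f -> pspan M g -> pspan (N + M) (f * g).
Proof.
apply: lspanM => _ _ [s <- ->] [s' <- ->]; apply: lspan_gen.
by exists (s ++ s'); rewrite big_cat.
Qed.

Lemma pspan_pw k : pspan k.*2.+1 (pw k).
Proof. by apply: lspan_gen; exists [:: k]; rewrite big_seq1. Qed.

Lemma pspan1 : pspan 0 1.
Proof. by apply: lspan_gen; exists [::]; rewrite big_nil. Qed.

Lemma pspan_q r : pspan r (q r).
Proof.
elim/ltn_ind: r => -[|r] IH; first by rewrite q0; apply: pspan1.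
rewrite -[q r.+1](scalerK (natF_neq0 r)) q_rec //; apply/lspanZ/lspan_sum => i _.
case oi: (odd i); first by rewrite mul0r; apply: LSpan0.
rewrite -scalerAl; apply: lspanZ.
have E : ((i./2).*2.+1 + (r - i) = r.+1)%N by move: (ltn_ord i); lia.
by have := pspanM (pspan_pw i./2) (IH (r - i)%N (leq_subr _ _)); rewrite E.
Qed.

Lemma qspan_pspan N d f : qspan N d f -> pspan N f.
Proof.
apply: lspan_sub => _ [mu [<- _ ->]]; elim: mu => [|a mu IH].
  by rewrite !big_nil; apply: pspan1.
by rewrite !big_cons; apply: pspanM (pspan_q a) IH.
Qed.

Lemma two_neq0 : (2 : F) != 0. Proof. exact: (natF_neq0 1). Qed.

Lemma qspan_pw k : qspan k.*2.+1 0 (pw k).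
Proof.
elim/ltn_ind: k => k IH.
rewrite -[pw k](scalerK two_neq0).
apply: lspanZ.
(* The last term of the recursion for q_(2k+1) is 2 p_(2k+1) q_0, and the other terms involve only
   earlier power sums. *)
have := q_rec natF_neq0 k.*2; rewrite big_ord_recr /= odd_double subnn q0 // mulr1.
rewrite doubleK => /eqP; rewrite addrC -subr_eq => /eqP <-; apply: lspanB.
  by apply/lspanZ/(qspan_le _ (qspan_q F _)).
apply: lspan_sum => i _.
case oi: (odd i); first by rewrite mul0r; apply: LSpan0.
rewrite -scalerAl; apply: lspanZ.
have E : ((i./2).*2.+1 + (k.*2 - i) = k.*2.+1)%N by move: (ltn_ord i); lia.
have ik : (i./2 < k)%N by move: (ltn_ord i); lia.
by have := qspanM (IH _ ik) (qspan_le (leq0n _) (qspan_q F (k.*2 - i))); rewrite E.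
Qed.

Lemma pspan_Qspan N f : pspan N f -> Qspan N f.
Proof.
move=> Nf; apply: (@qspan_Qspan N 0); move: Nf.
apply: lspan_sub => _ [s <- ->]; elim: s => [|a s IH].
  by rewrite !big_nil; apply: qspan1.
by rewrite !big_cons; apply: (@qspanM _ _ 0 _ _ 0) (qspan_pw a) IH.
Qed.

Lemma pspan_schurQ N (la : SP N) : pspan N (schurQ F la).
Proof.
have /and3P[sla _ /eqP laN] := partsP la.
have sla' : sorted geq la by move: sla; rewrite gtn_sorted_uniq_geq => /andP[].
have [c _ lead] := schurQ_lead natF_neq0 sla'.
rewrite sumnE in laN; rewrite laN in lead.
rewrite -[schurQ F la](subrK (c *: \prod_(i <- parts la) q i)); apply: lspanD.
  exact: qspan_pspan lead.
by apply/lspanZ; have := qspan_prod F la; rewrite laN; apply: qspan_pspan.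
Qed.

Lemma pspan_pscale (c : nat -> F) N f : pspan N f -> pspan N (pscale c f).
Proof.
elim=> [|a _ h [s sN ->] _ IH]; first by rewrite rmorph0; apply: LSpan0.
rewrite rmorphD /= pscaleZ; apply: lspanD IH; apply: lspanZ.
rewrite rmorph_prod /=; under eq_bigr => k _ do rewrite pscale_pw.
by rewrite scaler_prod; apply/lspanZ/lspan_gen; exists s.
Qed.

End SchurQSpanning.

(** * Linear independence of the Q_la *)

(** Uniqueness of binary digits: parity gives the lowest digit, and halving removes it. *)
Lemma binary_inj n (f g : nat -> bool) :
  (\sum_(a < n) f a * 2 ^ a = \sum_(a < n) g a * 2 ^ a)%N ->
  forall a, (a < n)%N -> f a = g a.
Proof.
elim: n f g => // n IH f g; rewrite !big_ord_recl /= !expn0 !muln1.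
have E (h : nat -> bool) : (\sum_(i < n) h (bump 0 i) * 2 ^ bump 0 i =
    2 * \sum_(i < n) h i.+1 * 2 ^ i)%N.
  by rewrite big_distrr; apply: eq_bigr => i _; rewrite /bump /= add1n expnS mulnCA.
rewrite !E => fg; have fg0 : f 0%N = g 0%N
  by move: fg; case: (f 0%N); case: (g 0%N); lia.
move=> [|a] an //; apply: (IH (fun a => f a.+1) (fun a => g a.+1)) => //.
by move: fg; rewrite fg0; lia.
Qed.

Lemma sum_pow2_uniq n (s : seq nat) : uniq s -> {in s, forall a, (a < n)%N} ->
  (\sum_(a <- s) 2 ^ a = \sum_(a < n) ((a : nat) \in s) * 2 ^ a)%N.
Proof.
move=> us sn; rewrite (perm_big [seq a <- iota 0 n | a \in s]).
  rewrite big_filter -{1}[n]subn0 -/(index_iota 0 n) big_mkcond big_mkord.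
  by apply: eq_bigr => a _; case: ifP => _; rewrite ?mul1n ?mul0n.
apply: uniq_perm => [//||a]; first by rewrite filter_uniq ?iota_uniq.
rewrite mem_filter mem_iota; case sa: (a \in s) => //=.
by rewrite add0n sn.
Qed.

Lemma sum_pow2_inj (s s' : seq nat) : uniq s -> uniq s' ->
  (\sum_(a <- s) 2 ^ a = \sum_(a <- s') 2 ^ a)%N -> s =i s'.
Proof.
move=> us us'; set n := (\max_(a <- s ++ s') a).+1.
have lt a : a \in s ++ s' -> (a < n)%N
  by move=> h; rewrite ltnS; apply: leq_bigmax_seq.
have sn : {in s, forall a, (a < n)%N} by move=> a h; apply: lt; rewrite mem_cat h.
have s'n : {in s', forall a, (a < n)%N}
  by move=> a h; apply: lt; rewrite mem_cat h orbT.
rewrite (sum_pow2_uniq us sn) (sum_pow2_uniq us' s'n) => E a.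
have [an|na] := ltnP a n; first exact: (binary_inj (f := mem s) (g := mem s') E).
by apply/idP/idP => [/sn|/s'n]; rewrite ltnNge na.
Qed.

(** For x > 0 with odd part 2k + 1 this is k, the index of the variable p_(2k+1). *)
Definition odd_index x := (x %/ 2 ^ logn 2 x)./2.

Lemma odd_indexE x : (0 < x)%N -> x = (2 ^ logn 2 x * (odd_index x).*2.+1)%N.
Proof.
move=> x0; rewrite /odd_index.
have [m] := @pfactor_coprime 2 x isT x0.
rewrite coprime2n; move: (logn 2 x) => k om ->; rewrite mulnK ?expn_gt0 // mulnC.
by congr (_ * _)%N; lia.
Qed.

(* Glaisher's map: the part 2^a (2k+1) is replaced by 2^a parts equal to 2k+1. *)
Definition glaisher (la : seq nat) : seq nat :=
  flatten [seq nseq (2 ^ logn 2 x) (odd_index x) | x <- la].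

Lemma sum_glaisher la : 0%N \notin la ->
  (\sum_(k <- glaisher la) k.*2.+1 = \sum_(x <- la) x)%N.
Proof.
rewrite /glaisher big_flatten big_map.
elim: la => [|x la IH]; first by rewrite !big_nil.
rewrite inE negb_or eq_sym -lt0n !big_cons => /andP[x0 la0]; rewrite (IH la0).
by rewrite big_nseq iter_addn_0 mulnC -odd_indexE.
Qed.

Lemma count_glaisher la i :
  count_mem i (glaisher la) =
  (\sum_(a <- [seq logn 2 x | x <- la & odd_index x == i]) 2 ^ a)%N.
Proof.
rewrite /glaisher count_flatten -map_comp sumnE big_map big_map big_filter
  [RHS]big_mkcond.
by apply: eq_bigr => x _; rewrite /= count_nseq /=; case: eqP => _;
  rewrite ?mul1n ?mul0n.
Qed.

(** Distinct parts with the same odd part 2i + 1 have distinct 2-adic valuations, so the binary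
    digits of the multiplicity of i tell which parts 2^a (2i+1) occur. *)
Lemma glaisher_inj la mu : uniq la -> uniq mu -> 0%N \notin la -> 0%N \notin mu ->
  (forall i, count_mem i (glaisher la) = count_mem i (glaisher mu)) -> la =i mu.
Proof.
move=> ula umu la0 mu0 E.
pose A i (s : seq nat) := [seq logn 2 x | x <- s & odd_index x == i].
have pos (s : seq nat) x : 0%N \notin s -> x \in s -> (0 < x)%N.
  by move=> s0; case: x => // xs; rewrite xs in s0.
have memA (s : seq nat) x : 0%N \notin s -> (0 < x)%N ->
    (x \in s) = (logn 2 x \in A (odd_index x) s).
  move=> s0 x0; apply/idP/mapP => [xs|[y]].
    by exists x => //; rewrite mem_filter eqxx.
  rewrite mem_filter => /andP[/eqP yx ys] xy.
  by rewrite (odd_indexE x0) xy -yx -odd_indexE // (pos s).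
have uA i (s : seq nat) : uniq s -> 0%N \notin s -> uniq (A i s).
  move=> us s0; rewrite map_inj_in_uniq ?filter_uniq // => x y.
  rewrite !mem_filter => /andP[/eqP xi xs] /andP[/eqP yi ys] xy.
  by rewrite (odd_indexE (pos _ _ s0 xs)) xy xi -yi -odd_indexE // (pos s).
move=> x; case: (posnP x) => [->|x0]; first by rewrite (negbTE la0) (negbTE mu0).
rewrite (memA la) // (memA mu) //; apply: sum_pow2_inj; try exact: uA.
by rewrite -!count_glaisher.
Qed.

Section Independence.
Variable F : fieldType.
Hypothesis natF_neq0 : forall n, n.+1%:R != 0 :> F.
Local Notation pw := (pw F).

Definition pmon (s : seq nat) : {cmonom nat} := \big[mmul/mone]_(k <- s) ucm k.

Lemma prod_pw s : \prod_(k <- s) pw k = << pmon s >>.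
Proof.
rewrite /pmon; elim: s => [|k s IH]; first by rewrite !big_nil mon1.
rewrite !big_cons {}IH /Defs.pw.
by rewrite monM.
Qed.

Lemma pmonE s i : pmon s i = count_mem i s.
Proof.
rewrite /pmon; elim: s => [|k s IH]; first by rewrite big_nil cm1.
by rewrite big_cons cmM IH ucmE.
Qed.

Lemma pmon_glaisher_inj N : injective (fun la : SP N => pmon (glaisher la)).
Proof.
move=> la mu E; apply/val_inj => /=.
have /and3P[sla la0 _] := partsP la; have /and3P[smu mu0 _] := partsP mu.
have tg : transitive gtn by move=> a b c ab bc; apply: ltn_trans bc ab.
have ag : antisymmetric gtn by move=> a b /andP[]; rewrite /gtn /=; lia.
apply: (sorted_eq tg ag sla smu).
have ula := sorted_uniq tg (fun x => ltnn x) sla.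
have umu := sorted_uniq tg (fun x => ltnn x) smu.
apply: (uniq_perm ula umu); apply: glaisher_inj => // i.
by rewrite -!pmonE E.
Qed.

(** A expands the Glaisher monomials in the Q_mu, and B holds the coefficients of the Q_mu at these
    monomials. Distinctness of the monomials gives A B = 1; both matrices are square, so B A = 1 and
    a relation c with c B = 0 vanishes. *)
Lemma schurQ_free N (c : SP N -> F) :
  \sum_mu c mu *: schurQ F mu = 0 -> forall mu, c mu = 0.
Proof.
pose m (la : SP N) := pmon (glaisher la).
have : forall la, exists a : SP N -> F, << m la >> = \sum_mu a mu *: schurQ F mu.
  move=> la; apply: lspan_fin; apply: (pspan_Qspan natF_neq0).
  have /and3P[_ la0 /eqP laN] := partsP la.
  apply: lspan_gen; exists (glaisher la); last by rewrite prod_pw.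
  by rewrite sum_glaisher // -sumnE.
case/fin_all_exists=> a aE c0 mu.
pose A : 'M[F]_#|{: SP N}| := \matrix_(i, j) a (enum_val i) (enum_val j).
pose B : 'M[F]_#|{: SP N}| :=
  \matrix_(i, j) mcoeff (m (enum_val j)) (schurQ F (enum_val i : SP N)).
have sumB (d : SP N -> F) j : \sum_i d (enum_val i) * B i j =
    mcoeff (m (enum_val j)) (\sum_mu d mu *: schurQ F mu).
  rewrite raddf_sum /= (reindex _ (onW_bij _ (@enum_val_bij (SP N)))) /=.
  by apply: eq_bigr => i _; rewrite [B i j]mxE [RHS]mcoeffZ.
have AB : A *m B = 1%:M.
  apply/matrixP => i j; rewrite !mxE.
  under eq_bigr => k _ do rewrite [A _ _]mxE.
  rewrite (sumB (a (enum_val i))) -aE mcoeffU1; congr (_%:R).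
  by rewrite (inj_eq (@pmon_glaisher_inj N)) (inj_eq enum_val_inj).
have BA := mulmx1C AB.
pose v : 'rV[F]_#|{: SP N}| := \row_i c (enum_val i).
have vB : v *m B = 0.
  apply/rowP => j; rewrite !mxE; under eq_bigr => k _ do rewrite [v _ _]mxE.
  by rewrite (sumB c) c0 raddf0.
have v0 : v = 0 by rewrite -[v]mulmx1 -BA mulmxA vB mul0mx.
have := congr1 (fun w : 'rV_ _ => w 0 (enum_rank mu)) v0.
by rewrite !mxE enum_rankK.
Qed.

End Independence.

(** * Transition matrices *)

Lemma sum_scalerBl_eq0 (F : fieldType) (V : lmodType F) (I : finType)
    (a b : I -> F) (e : I -> V) :
  \sum_i a i *: e i = \sum_i b i *: e i -> \sum_i (a i - b i) *: e i = 0.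
Proof.
by move=> E; under eq_bigr do rewrite scalerBl; rewrite sumrB E subrr.
Qed.

Lemma sum_scaler_sum (F : fieldType) (V : lmodType F) (I J : finType)
    (a : I -> F) (b : I -> J -> F) (e : J -> V) (f : I -> V) :
  (forall i, f i = \sum_j b i j *: e j) ->
  \sum_i a i *: f i = \sum_j (\sum_i a i * b i j) *: e j.
Proof.
move=> fE; under eq_bigr do rewrite fE scaler_sumr.
rewrite exchange_big; apply: eq_bigr => j _.
by rewrite scaler_suml; apply: eq_bigr => i _; rewrite scalerA.
Qed.

Section Transition.
Variable F : fieldType.
Hypothesis natF_neq0 : forall n, n.+1%:R != 0 :> F.
Variable N : nat.
Local Notation Q := (schurQ F).

Lemma pscale_lin_sum d (c : SP N -> F) (f : SP N -> Gam F) :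
  pscale d (\sum_mu c mu *: f mu) = \sum_mu c mu *: pscale d (f mu).
Proof. by rewrite raddf_sum; apply: eq_bigr => mu _; exact: pscaleZ. Qed.

Lemma Tmap_lin_sum t s (c : SP N -> F) (f : SP N -> Gam F) :
  Tmap t s (\sum_mu c mu *: f mu) = \sum_mu c mu *: Tmap t s (f mu).
Proof. by rewrite /Tmap /rho pscale_lin_sum; exact: pscale_lin_sum. Qed.

Lemma is_transition_ex t s : exists M, @is_transition F N t s M.
Proof.
have : forall la : SP N, exists c : SP N -> F, Tmap t s (Q la) = \sum_mu c mu *: Q mu.
  move=> la; apply/lspan_fin/(pspan_Qspan natF_neq0).
  exact/pspan_pscale/pspan_pscale/pspan_schurQ.
case/fin_all_exists=> c cE.
exists (\matrix_(i, j) c (enum_val i) (enum_val j)) => la.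
by rewrite cE; apply: eq_bigr => mu _; rewrite mxE !enum_rankK.
Qed.

Lemma is_transition_uniq t s M M' :
  @is_transition F N t s M -> @is_transition F N t s M' -> M = M'.
Proof.
move=> MP M'P; apply/matrixP => i j.
have E0 : \sum_(mu : SP N) (M i (enum_rank mu) - M' i (enum_rank mu)) *: Q mu = 0.
  have := etrans (esym (MP (enum_val i))) (M'P (enum_val i)); rewrite enum_valK.
  exact: sum_scalerBl_eq0.
have := schurQ_free natF_neq0 E0 (enum_val j); rewrite enum_valK => /eqP.
by rewrite subr_eq0 => /eqP.
Qed.

Lemma CmxP t s : is_transition t s (@Cmx F N t s).
Proof. exact: epsilon_spec (is_transition_ex t s). Qed.

Lemma CmxE t s M : is_transition t s M -> @Cmx F N t s = M.
Proof. exact: is_transition_uniq (CmxP t s). Qed.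

(** The condition under which [rhoV t] inverts [rho t]. *)
Definition odd_pow_neq1 (t : F) := forall n, odd n -> 1 - t ^+ n != 0.

Lemma Cmx_mul t s r : odd_pow_neq1 s -> @Cmx F N t r = Cmx N t s *m Cmx N s r.
Proof.
move=> sP; apply: CmxE => la.
(* In the composite, [rho s] meets [rhoV s] and the two cancel. *)
have -> : Tmap t r (Q la) = Tmap s r (Tmap t s (Q la)) by rewrite /Tmap rhoVK.
rewrite CmxP Tmap_lin_sum.
apply: etrans (sum_scaler_sum _ (CmxP s r)) _.
apply: eq_bigr => nu _; rewrite [in RHS]mxE.
by rewrite [in RHS](reindex _ (onW_bij _ (@enum_rank_bij (SP N)))).
Qed.

Lemma Cmx_id t : odd_pow_neq1 t -> @Cmx F N t t = 1%:M.
Proof.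
move=> tP; apply: CmxE => la; rewrite /Tmap rhoK //.
rewrite (bigD1 la) //= mxE eqxx scale1r big1 ?addr0 // => mu mula.
by rewrite mxE (inj_eq enum_rank_inj) eq_sym (negbTE mula) scale0r.
Qed.

End Transition.

(** * Rational functions in three independent parameters *)

Section IndependentParameters.
Import mpoly.

Lemma Kpar_natr_neq0 n : n.+1%:R != 0 :> Kpar.
Proof.
rewrite -(rmorph_nat (@tofrac {mpoly rat[3]})) tofrac_eq0.
by rewrite -mpolyC_nat mpolyC_eq0 Num.Theory.pnatr_eq0.
Qed.

Lemma par_odd_pow_neq1 i : odd_pow_neq1 (par i).
Proof.
move=> n on; rewrite subr_eq0 /par -rmorphXn.
rewrite -(rmorph1 (@tofrac {mpoly rat[3]})) tofrac_eq.
(* At the origin X_i^n = 1 would read 0 = 1, since an odd n is positive. *)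
apply/eqP => /(congr1 (meval (fun=> 0))).
rewrite rmorphXn rmorph1 /= mevalXU; case: n on => // n _.
by rewrite expr0n => /eqP; rewrite oner_eq0.
Qed.

End IndependentParameters.

Theorem proposition3p2 (N : nat) :
  let t : Kpar := par 0 in
  let s : Kpar := par 1 in
  let r : Kpar := par 2 in
  [/\ Cmx N t r = Cmx N t s *m Cmx N s r,
      Cmx N t t = 1%:M,
      Cmx N t s \in unitmx
    & invmx (Cmx N t s) = Cmx N s t].
Proof.
move=> t s r.
have mulC := Cmx_mul Kpar_natr_neq0 N.
have CC : Cmx N t s *m Cmx N s t = 1%:M.
  rewrite -(mulC _ _ _ (par_odd_pow_neq1 1)).
  exact (Cmx_id Kpar_natr_neq0 N (par_odd_pow_neq1 0)).
(* For square matrices a one-sided inverse already gives invertibility. *)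
have /mulmx1_unit[tsU stU] := CC.
split.
- exact (mulC _ _ _ (par_odd_pow_neq1 1)).
- exact (Cmx_id Kpar_natr_neq0 N (par_odd_pow_neq1 0)).
- exact: tsU.
by rewrite -[RHS](mulKmx tsU) CC mulmx1.
Qed.
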